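(* Problem (PL2b) is normal: whenever $(x^{[i]},u^{[i]})_{i=1}^N$ solves (PL2b) and $\lambda_0\ge 0$, $\lambda^{[i]}\in W^{1,\infty}(0,1;\mathbb{R}^n)$, $i=1,\ldots,N$, are multipliers satisfying the maximum-principle conditions (a)–(d) listed in the context, one has $\lambda_0>0$. Subsequently, one can set $\lambda_0=1$ for Problem (PL2b) (after rescaling the multipliers) and express the optimal control as $u(t)=-\lambda(t)$ for a.e. $t\in[t_0,t_f)$.
   Context: Let $t_0<t_1<\cdots<t_N=:t_f$, $\tau_i:=t_i-t_{i-1}$, and let $z_0,\ldots,z_N\in\mathbb{R}^n$ with $z_i\ne z_{i-1}$, $i=1,\ldots,N$. Let $f:\mathbb{R}^n\times[t_0,t_f]\to\mathbb{R}^n$ be continuous and continuously differentiable in its first argument, and write $f^{[i]}(x,s):=f(x,t_{i-1}+s\tau_i)$. Problem (PL2b): minimize $\frac12\sum_{i=1}^N\tau_i\int_0^1\|u^{[i]}(s)\|^2ds$ over $x^{[i]}\in W^{1,\infty}(0,1;\mathbb{R}^n)$, $u^{[i]}\in L^\infty(0,1;\mathbb{R}^n)$ subject to $\dot x^{[i]}(s)=\tau_i\big(f^{[i]}(x^{[i]}(s),s)+u^{[i]}(s)\big)$ for a.e. $s\in[0,1]$, $x^{[i]}(0)=z_{i-1}$, $x^{[i]}(1)=z_i$, $i=1,\ldots,N$. Here $\|\cdot\|$ is the Euclidean norm. Hamiltonian of stage $i$: $H^{[i]}(x,\lambda_0,\lambda,u,s)=\tau_i\big(\tfrac12\lambda_0\|u\|^2+\lambda^T(f^{[i]}(x,s)+u)\big)$.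 Maximum-principle conditions on the multipliers: (a) $(\lambda_0,\lambda^{[i]}(s))\neq 0$ for every $s\in[0,1]$ and $i=1,\ldots,N$; (b) $\dot\lambda^{[i]}_j(s)=-\partial H^{[i]}/\partial x_j$ evaluated at $(x^{[i]}(s),\lambda_0,\lambda^{[i]}(s),u^{[i]}(s),s)$, for a.e. $s\in[0,1]$, $j=1,\ldots,n$; (c) $\lambda^{[i+1]}_j(0)=\lambda^{[i]}_j(1)+\delta^{[i]}_j$ for some real constants $\delta^{[i]}_j$, $i=1,\ldots,N-1$ (jumps are allowed); (d) $u^{[i]}(s)\in\operatorname{argmin}_{w\in\mathbb{R}^n}H^{[i]}(x^{[i]}(s),\lambda_0,\lambda^{[i]}(s),w,s)$ for a.e. $s\in[0,1]$. The overall adjoint and control are obtained by concatenation: $\lambda(t):=\lambda^{[i]}(s)$ and $u(t):=u^{[i]}(s)$ for $t=t_{i-1}+s\tau_i$, $s\in[0,1]$. The problem is called normal if $\lambda_0>0$ and abnormal if $\lambda_0=0$. *)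

(* Defs.v *)
From HB Require Import structures.
From mathcomp Require Import all_boot all_order all_algebra.
From mathcomp Require Import all_classical all_reals all_analysis.

Set Implicit Arguments.
Unset Strict Implicit.
Unset Printing Implicit Defensive.

Import Order.TTheory GRing.Theory Num.Theory.
Import numFieldNormedType.Exports.

Local Open Scope classical_set_scope.
Local Open Scope ring_scope.

Definition dot (R : realType) (n : nat) (v w : 'rV[R]_n) : R :=
  \sum_j v 0 j * w 0 j.

(* The library norm `|v| on 'rV[R]_n is the maximum norm. *)
Definition enorm (R : realType) (n : nat) (v : 'rV[R]_n) : R :=
  Num.sqrt (dot v v).

Definition argmin (R : realType) (T : Type) (h : T -> R) : set T :=
  [set w | forall w', h w <= h w'].

(** Function spaces on (0,1); values outside the interval are irrelevant. *)

Definition Linfty01 (R : realType) (n : nat) (v : R -> 'rV[R]_n) : Prop :=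
  forall j, (fun s => v s 0 j) \_ `]0, 1[ \in Lfun (@lebesgue_measure R) +oo%E.

Definition test_function01 (R : realType) (phi : R -> R) : Prop :=
  (forall (k : nat) (s : R), derivable (derive1n k phi) s 1) /\
  exists a b : R, [/\ 0 < a, b < 1 & forall s, ~~ (a <= s <= b) -> phi s = 0].

Definition weak_derivative01 (R : realType) (n : nat)
    (x v : R -> 'rV[R]_n) : Prop :=
  forall phi : R -> R, test_function01 phi -> forall j,
  \int[lebesgue_measure]_(s in `]0, 1[) (x s 0 j * derive1 phi s) =
  - \int[lebesgue_measure]_(s in `]0, 1[) (v s 0 j * phi s).

(* Since elements of W^{1,infty} are evaluated pointwise, in particular at 0
   and 1, they are represented by their continuous version on [0,1]. *)
Definition W1infty01 (R : realType) (n : nat) (x : R -> 'rV[R]_n) : Prop :=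
  [/\ {within `[0, 1], continuous x}, Linfty01 x &
      exists2 v, Linfty01 v & weak_derivative01 x v].

(** Stages: i : 'I_N, counted from 0, stands for the interval between the
    knots of index i and i+1 among the N+1 knots. *)

Definition start_knot (N : nat) (i : 'I_N) : 'I_N.+1 :=
  widen_ord (leqnSn N) i.

Definition end_knot (N : nat) (i : 'I_N) : 'I_N.+1 := lift ord0 i.

Definition tau (R : realType) (N : nat) (t : 'I_N.+1 -> R) (i : 'I_N) : R :=
  t (end_knot i) - t (start_knot i).

Definition stage_f (R : realType) (N n : nat) (t : 'I_N.+1 -> R)
    (f : 'rV[R]_n -> R -> 'rV[R]_n) (i : 'I_N) (x : 'rV[R]_n) (s : R) :
    'rV[R]_n :=
  f x (t (start_knot i) + s * tau t i).

(* The two one-sided values at an interior knot may differ; the value taken is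
   the one of the stage starting there.  The default 0 is only reached outside
   [t_0, t_f[. *)
Definition concat (R : realType) (N n : nat) (t : 'I_N.+1 -> R)
    (y : 'I_N -> R -> 'rV[R]_n) (r : R) : 'rV[R]_n :=
  if [pick i : 'I_N | t (start_knot i) <= r < t (end_knot i)] is Some i
  then y i ((r - t (start_knot i)) / tau t i)
  else 0.

Definition PL2b_cost (R : realType) (N n : nat) (t : 'I_N.+1 -> R)
    (u : 'I_N -> R -> 'rV[R]_n) : R :=
  2^-1 * \sum_i
    tau t i * \int[lebesgue_measure]_(s in `[0, 1]) (enorm (u i s) ^+ 2).

Record PL2b_feasible (R : realType) (N n : nat) (t : 'I_N.+1 -> R)
    (z : 'I_N.+1 -> 'rV[R]_n) (f : 'rV[R]_n -> R -> 'rV[R]_n)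
    (x u : 'I_N -> R -> 'rV[R]_n) : Prop := {
  feasible_state : forall i, W1infty01 (x i);
  feasible_control : forall i, Linfty01 (u i);
  feasible_dynamics : forall i,
    {ae lebesgue_measure, forall s : R, 0 <= s <= 1 ->
      is_derive s 1 (x i) (tau t i *: (stage_f t f i (x i s) s + u i s))};
  feasible_start : forall i, x i 0 = z (start_knot i);
  feasible_end : forall i, x i 1 = z (end_knot i)
}.

Definition PL2b_solution (R : realType) (N n : nat) (t : 'I_N.+1 -> R)
    (z : 'I_N.+1 -> 'rV[R]_n) (f : 'rV[R]_n -> R -> 'rV[R]_n)
    (x u : 'I_N -> R -> 'rV[R]_n) : Prop :=
  PL2b_feasible t z f x u /\
  forall x' u' : 'I_N -> R -> 'rV[R]_n, PL2b_feasible t z f x' u' ->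
    PL2b_cost t u <= PL2b_cost t u'.

Definition hamiltonian (R : realType) (N n : nat) (t : 'I_N.+1 -> R)
    (f : 'rV[R]_n -> R -> 'rV[R]_n) (i : 'I_N)
    (x : 'rV[R]_n) (lam0 : R) (lam u : 'rV[R]_n) (s : R) : R :=
  tau t i * (2^-1 * lam0 * enorm u ^+ 2 + dot lam (stage_f t f i x s + u)).

Record PMP_conditions (R : realType) (N n : nat) (t : 'I_N.+1 -> R)
    (f : 'rV[R]_n -> R -> 'rV[R]_n) (x u : 'I_N -> R -> 'rV[R]_n)
    (lam0 : R) (lam : 'I_N -> R -> 'rV[R]_n) : Prop := {
  PMP_nontrivial : forall i (s : R), 0 <= s <= 1 -> (lam0, lam i s) <> (0, 0);
  PMP_adjoint : forall i (j : 'I_n),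
    {ae lebesgue_measure, forall s : R, 0 <= s <= 1 ->
      is_derive s 1 (fun r => lam i r 0 j)
        (- 'D_(delta_mx 0 j)
             (fun y => hamiltonian t f i y lam0 (lam i s) (u i s) s) (x i s))};
  PMP_jump : exists delta : 'I_N -> 'rV[R]_n,
    forall i i' : 'I_N, i' = i.+1 :> nat ->
      forall j, lam i' 0 0 j = lam i 1 0 j + delta i 0 j;
  PMP_minimum : forall i,
    {ae lebesgue_measure, forall s : R, 0 <= s <= 1 ->
      argmin (fun w => hamiltonian t f i (x i s) lam0 (lam i s) w s) (u i s)}
}.

Record PL2b_multipliers (R : realType) (N n : nat) (t : 'I_N.+1 -> R)
    (f : 'rV[R]_n -> R -> 'rV[R]_n) (x u : 'I_N -> R -> 'rV[R]_n)
    (lam0 : R) (lam : 'I_N -> R -> 'rV[R]_n) : Prop := {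
  multiplier_ge0 : 0 <= lam0;
  multiplier_W1infty : forall i, W1infty01 (lam i);
  multiplier_PMP : PMP_conditions t f x u lam0 lam
}.

(* Main.v *)
(* If lam0 = 0, the Hamiltonian is affine in the control with slope a positive
   multiple of lam, so it has a minimum only if lam vanishes, which the
   nontriviality condition forbids.  If lam0 > 0, it is strictly convex and
   quadratic in the control, with minimizer - lam / lam0.  The rescaled
   multipliers are admissible because all conditions are positively homogeneous
   in (lam0, lam). *)

Require Import Defs.
From HB Require Import structures.
From mathcomp Require Import all_boot all_order all_algebra.
From mathcomp Require Import all_classical all_reals all_analysis.
From mathcomp Require Import measurable_realfun.
From mathcomp Require Import ring lra.
Import Order.TTheory GRing.Theory Num.Theory.
Import numFieldNormedType.Exports.
Local Open Scope classical_set_scope.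
Local Open Scope ring_scope.

(** * Bilinearity and positivity of the Euclidean product *)

Section dot_product.
Context {R : realType} {n : nat}.
Implicit Types (u v w : 'rV[R]_n) (k : R).

Lemma dotDr u v w : dot u (v + w) = dot u v + dot u w.
Proof.
by rewrite /dot -big_split; apply: eq_bigr => j _; rewrite mxE mulrDr.
Qed.

Lemma dotC v w : dot v w = dot w v.
Proof. by apply: eq_bigr => j _; rewrite mulrC. Qed.

Lemma dotDl u v w : dot (u + v) w = dot u w + dot v w.
Proof. by rewrite dotC dotDr !(dotC w). Qed.

Lemma dotZr k v w : dot v (k *: w) = k * dot v w.
Proof.
by rewrite /dot mulr_sumr; apply: eq_bigr => j _; rewrite mxE mulrCA.
Qed.

Lemma dotZl k v w : dot (k *: v) w = k * dot v w.
Proof. by rewrite dotC dotZr dotC. Qed.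

Lemma dot_ge0 v : 0 <= dot v v.
Proof. by apply: sumr_ge0 => j _; rewrite -expr2 sqr_ge0. Qed.

Lemma dot_le0_eq0 v : dot v v <= 0 -> v = 0.
Proof.
move=> v0; apply/rowP => j; apply/eqP; rewrite mxE -sqrf_eq0 expr2.
have /psumr_eq0P dv0 : forall i, true -> 0 <= v 0 i * v 0 i.
  by move=> i _; rewrite -expr2 sqr_ge0.
by rewrite dv0//; apply/eqP; rewrite -/(dot v v) eq_le v0 dot_ge0.
Qed.

Lemma sqr_enorm v : enorm v ^+ 2 = dot v v.
Proof. by rewrite sqr_sqrtr// dot_ge0. Qed.

End dot_product.

(** * Null sets and integrals under affine changes and positive scaling *)

Section lebesgue_negligible.
Context {R : realType}.
Local Notation mu := (@lebesgue_measure R).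

Lemma ae_lebesgue_filter : Filter (almost_everywhere mu).
Proof. exact: (ae_filter_ringOfSetsType mu). Qed.

(** Otherwise the exceptional null set would contain [0, 1], which has measure 1. *)
Lemma ae_itv01_exists (P : R -> Prop) :
  {ae mu, forall s : R, 0 <= s <= 1 -> P s} ->
  exists2 s : R, 0 <= s <= 1 & P s.
Proof.
move=> aeP; apply: contrapT => nP.
have : mu.-negligible [set` `[0 : R, 1]].
  apply: negligibleS aeP => s /=; rewrite in_itv/= => s01 Ps.
  by apply: nP; exists s => //; exact: Ps.
have mu01 : mu [set` `[0 : R, 1]] = 1%E.
  by rewrite lebesgue_measure_itv/= lte_fin ltr01 oppr0 adde0.
move/negligibleP => /(_ (measurable_itv _)) mu0.
by have /eqP := etrans (esym mu01) mu0; rewrite onee_eq0.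
Qed.

Lemma measurable_affine (a b : R) :
  measurable_fun [set: R] (fun r => (r - a) / b).
Proof.
by apply: measurable_funM; [exact: measurable_funB | exact: measurable_cst].
Qed.

(** By uniqueness of Lebesgue measure: the right-hand side is a scaled pushforward, so it suffices
    to compare lengths of intervals []c, d]]. *)
Lemma lebesgue_measure_affine (a b : R) (A : set R) : 0 < b -> measurable A ->
  mu A = (b^-1%:E * mu ((fun r => (r - a) / b)%R @^-1` A))%E.
Proof.
move=> b0 mA; pose g (r : R) : measurableTypeR R := (r - a) / b.
have mg : measurable_fun [set: measurableTypeR R] g by exact: measurable_affine.
have bi0 : 0 <= b^-1 by rewrite invr_ge0 ltW.
rewrite -[RHS]/(pushforward (mscale (NngNum bi0) mu) g A).
apply: lebesgue_measure_unique => //= _ [[c d] _ <-].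
rewrite /pushforward /mscale/=.
have -> : g @^-1` `]c, d] = `](b * c + a), (b * d + a)]%classic.
  apply/seteqP; split => r /=; rewrite !in_itv/= ltr_pdivlMr// ler_pdivrMr//;
  lra.
rewrite !lebesgue_measure_itv/= !lte_fin ltrD2r ltr_pM2l//.
case: ifPn => _; last by rewrite mule0.
by rewrite -!EFinB -EFinM; congr EFin; field; rewrite gt_eqF.
Qed.

(** Carries almost-everywhere statements from stage time to global time: the affine preimage of a
    null set is null. *)
Lemma ae_affine (a b : R) (P : R -> Prop) : 0 < b ->
  {ae mu, forall s : R, P s} -> {ae mu, forall r : R, P ((r - a) / b)}.
Proof.
move=> b0 [A [mA A0 PA]]; exists ((fun r => (r - a) / b) @^-1` A); split.
- by rewrite -[X in measurable X]setTI; exact: measurable_affine.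
- have := lebesgue_measure_affine a b A b0 mA.
  rewrite A0 => /esym/eqP; rewrite mule_eq0 eqe invr_eq0 gt_eqF//= => /eqP.
  exact.
- by move=> r; exact: PA.
Qed.

(** Multiplying by a positive real fixes both infinities, so the identity survives even the
    conventional value of an infinite difference. *)
Lemma gt0_muleBr (k : R) (x y : \bar R) : 0 < k ->
  (k%:E * x - k%:E * y = k%:E * (x - y))%E.
Proof.
move=> k0; have k0' : (0 < k%:E)%E by rewrite lte_fin.
case: x => [x||]; case: y => [y||];
  rewrite -?EFinM/= ?(gt0_muley, gt0_muleNy)//=
    ?(addNye, addeNy, addye, addey, gt0_muley, gt0_muleNy)//.
by rewrite -EFinD mulrBr.
Qed.

(* Unlike in RintegralZl, no integrability is required: an infinite or
   undefined integral has the junk value 0, and both sides are then 0. *)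
Lemma Rintegral_pMl (k : R) (D : set R) (f : R -> R) : 0 < k ->
  measurable D -> measurable_fun D f ->
  \int[mu]_(s in D) (k * f s) = k * \int[mu]_(s in D) f s.
Proof.
move=> k0 mD mf.
have mF : measurable_fun D (EFin \o f) by exact/measurable_EFinP.
rewrite /Rintegral.
have -> : (\int[mu]_(s in D) (k * f s)%:E =
    k%:E * \int[mu]_(s in D) (f s)%:E)%E.
  under eq_integral do rewrite EFinM.
  rewrite integralE [in RHS]integralE.
  rewrite (ge0_funeposM _ (ltW k0)) (ge0_funenegM _ (ltW k0)).
  rewrite !ge0_integralZl_EFin ?ltW//; last 2 first.
  - exact: measurable_funeneg.
  - exact: measurable_funepos.
  exact: gt0_muleBr.
case: (\int[mu]_(s in D) (f s)%:E)%E => [r||]//=; rewrite mulr0.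
- by rewrite gt0_muley.
- by rewrite gt0_muleNy.
Qed.

End lebesgue_negligible.

(** * Stability of the function spaces under rescaling *)

Section rescaling.
Context {R : realType} {n : nat}.
Implicit Types (x v : R -> 'rV[R]_n) (k : R).
Local Notation mu := (@lebesgue_measure R).

Lemma Linfty01Z k v : Linfty01 v -> Linfty01 (fun s => k *: v s).
Proof.
move=> v_oo j.
have -> : (fun s => (k *: v s) 0 j) \_ `]0, 1[ =
    k *: ((fun s => v s 0 j) \_ `]0, 1[ : R -> R).
  apply/funext => s; rewrite /patch/= /GRing.scale/=; case: ifP => _.
    by rewrite mxE.
  exact/esym/mulr0.
have p1 : (1 <= +oo :> \bar R)%E by rewrite leey.
have [Lfun0 /(_ k)] := Lfun_submod_closed mu p1.
(* Closure is available for [k *: g + h]; here [h] is 0. *)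
by move=> /(_ _ 0 (v_oo j) Lfun0); rewrite addr0.
Qed.

Lemma measurable_Linfty01 v j :
  Linfty01 v -> measurable_fun (`]0, 1[%classic : set R) (fun s => v s 0 j).
Proof.
move=> /(_ j)/sub_Lfun_mfun; rewrite inE => mv.
by apply/(measurable_restrictT _ _).2.
Qed.

Lemma measurable_test_function (phi : R -> R) m (D : set R) :
  measurable D -> test_function01 phi -> measurable_fun D (derive1n m phi).
Proof.
move=> mD [phi_smooth _]; apply: (@measurable_funS _ _ _ _ setT) => //.
apply: continuous_measurable_fun => s; apply: differentiable_continuous.
exact/derivable1_diffP.
Qed.

Lemma weak_derivative01Z k x v : 0 < k -> Linfty01 x -> Linfty01 v ->
  weak_derivative01 x v ->
  weak_derivative01 (fun s => k *: x s) (fun s => k *: v s).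
Proof.
move=> k0 x_oo v_oo xv phi phiP j.
under eq_Rintegral do rewrite mxE -mulrA.
under [in RHS]eq_Rintegral do rewrite mxE -mulrA.
(* Only measurability of the two products remains; [phi] and its derivative are the iterated
   derivatives of order 0 and 1. *)
rewrite !Rintegral_pMl//.
- by rewrite xv// mulrN.
- apply: measurable_funM; first exact: measurable_Linfty01.
  exact: (@measurable_test_function phi 0).
- apply: measurable_funM; first exact: measurable_Linfty01.
  exact: (@measurable_test_function phi 1).
Qed.

Lemma W1infty01Z k x : 0 < k -> W1infty01 x -> W1infty01 (fun s => k *: x s).
Proof.
move=> k0 [xc x_oo [v v_oo xv]]; split.
- by move=> s; apply: cvgZl_tmp; exact: xc.
- exact: Linfty01Z.
- by exists (fun s => k *: v s); [exact: Linfty01Z | exact: weak_derivative01Z].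
Qed.

End rescaling.

(** * Minimizers, homogeneity and differentiability of the Hamiltonian *)

Section hamiltonian_theory.
Context {R : realType} {N n : nat} (t : 'I_N.+1 -> R)
  (f : 'rV[R]_n -> R -> 'rV[R]_n).
Implicit Types (lam u x : 'rV[R]_n) (k l : R) (i : 'I_N).

Lemma hamiltonianZ k i x l lam u s :
  hamiltonian t f i x (k * l) (k *: lam) u s =
  k * hamiltonian t f i x l lam u s.
Proof. by rewrite /hamiltonian dotZl; ring. Qed.

Lemma argmin_hamiltonian_abnormal i x lam u s : 0 < tau t i ->
  argmin (fun w => hamiltonian t f i x 0 lam w s) u -> lam = 0.
Proof.
(* The competitor [u - lam] lowers the affine Hamiltonian by a positive multiple of [dot lam lam],
   which must therefore vanish. *)
move=> t0 /(_ (u - lam)); rewrite /hamiltonian ler_pM2l// !dotDr.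
rewrite -scaleN1r dotZr => h; apply: dot_le0_eq0; lra.
Qed.

Lemma argmin_hamiltonian_normal i x l lam u s : 0 < tau t i -> 0 < l ->
  argmin (fun w => hamiltonian t f i x l lam w s) u ->
  u = - (l^-1 *: lam).
Proof.
move=> t0 l0 /(_ (- (l^-1 *: lam))).
rewrite /hamiltonian ler_pM2l// !dotDr !sqr_enorm => h.
apply/eqP; rewrite -addr_eq0; apply/eqP/dot_le0_eq0.
(* Completing the square: the difference of the two values of the Hamiltonian
   is [l / 2] times the squared norm of [u + lam / l]. *)
rewrite -(pmulr_rle0 _ l0); move: h.
rewrite -scaleNr !(dotDr, dotDl, dotZl, dotZr) (dotC u lam).
set a := dot u u; set b := dot lam u; set c := dot lam lam.
have e1 : 2^-1 * l * (- l^-1 * (- l^-1 * c)) = 2^-1 * l^-1 * c.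
  by field; rewrite gt_eqF.
have e2 : l * (a + l^-1 * b + (l^-1 * b + l^-1 * (l^-1 * c))) =
  l * a + 2 * b + l^-1 * c by field; rewrite gt_eqF.
by rewrite e1 e2; lra.
Qed.

Lemma knots_nondecreasing :
  (forall i : 'I_N, t (start_knot i) < t (end_knot i)) ->
  {homo t : j k / (j <= k)%N >-> j <= k}.
Proof.
(* Freezing the knots beyond [N] gives a sequence on all naturals, whose monotonicity follows from
   consecutive terms. *)
move=> t_incr; pose g m := t (inord (minn m N)).
have g_mono : {homo g : a b / (a <= b)%N >-> a <= b}.
  apply: homo_leq => [a|b a c|m]; [exact: lexx | exact: le_trans |].
  rewrite /g; have [mN|Nm] := ltnP m N; last by rewrite (minn_idPr (leqW Nm)).
  rewrite (minn_idPl mN).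
  have := ltW (t_incr (Ordinal mN)).
  congr (t _ <= t _); apply: val_inj; rewrite /= inordK//; exact: leqW.
have gE (j : 'I_N.+1) : t j = g j.
  by rewrite /g (minn_idPl (leq_ord j)) inord_val.
by move=> j k jk; rewrite !gE; exact: g_mono.
Qed.

(** The stage time is a convex combination of two knots; this places it where [f] is assumed
    smooth. *)
Lemma stage_time_itv i s : (forall i, t (start_knot i) < t (end_knot i)) ->
  0 <= s <= 1 -> t ord0 <= t (start_knot i) + s * tau t i <= t ord_max.
Proof.
move=> t_incr /andP[s0 s1].
have t_mono := knots_nondecreasing t_incr.
have := t_mono ord0 (start_knot i) isT.
have := t_mono (end_knot i) ord_max (leq_ord _).
have := t_incr i; rewrite /tau; set a := t (start_knot i).
set b := t (end_knot i) => ab b_le le_a; apply/andP; split; nra.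
Qed.

(** Lets the factor [lam0^-1] leave the directional derivative in the adjoint equation. The state
    enters only through a finite sum of coordinates of [f]. *)
Lemma derivable_hamiltonian i l lam u s x v :
  differentiable (f^~ (t (start_knot i) + s * tau t i)) x ->
  derivable (fun y => hamiltonian t f i y l lam u s) x v.
Proof.
move=> df; apply: diff_derivable; apply: differentiableM => //.
apply: differentiableD => //.
rewrite (_ : (fun y => _) = \sum_j (fun y => lam 0 j *
  (stage_f t f i y s + u) 0 j)); last by apply/funext => y; rewrite fct_sumE.
apply: differentiable_sum => j; apply: differentiableM => //.
apply: (@differentiable_comp _ _ _ _ (fun y => stage_f t f i y s + u)
  (fun w : 'rV[R]_n => w 0 j)); last exact: differentiable_coord.
exact: differentiableD.
Qed.

End hamiltonian_theory.

(** * Normality, rescaled multipliers and the control formula *)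

Theorem lemma1 (R : realType) (N n : nat) (t : 'I_N.+1 -> R)
    (z : 'I_N.+1 -> 'rV[R]_n) (f : 'rV[R]_n -> R -> 'rV[R]_n)
    (N_gt0 : (0 < N)%N)
    (t_incr : forall i : 'I_N, t (start_knot i) < t (end_knot i))
    (z_neq : forall i : 'I_N, z (end_knot i) <> z (start_knot i))
    (f_cont : {within [set p : 'rV[R]_n * R | t ord0 <= p.2 <= t ord_max],
                 continuous (fun p => f p.1 p.2)})
    (f_C1 : forall r : R, t ord0 <= r <= t ord_max ->
       (forall y, differentiable (f^~ r) y) /\
       continuous (fun y => jacobian (f^~ r) y)) :
  forall (x u : 'I_N -> R -> 'rV[R]_n) (lam0 : R) (lam : 'I_N -> R -> 'rV[R]_n),
    PL2b_solution t z f x u ->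
    PL2b_multipliers t f x u lam0 lam ->
    0 < lam0 /\
    (let mu := fun (i : 'I_N) (s : R) => lam0^-1 *: lam i s in
     PL2b_multipliers t f x u 1 mu /\
     {ae lebesgue_measure, forall r : R, t ord0 <= r < t ord_max ->
        concat t u r = - concat t mu r}).
Proof.
move=> x u lam0 lam [[xW u_oo _ _ _] _] [lam0_ge0 lamW [nontriv adj jump umin]].
have tau_gt0 i : 0 < tau t i by rewrite subr_gt0.
have lam0_gt0 : 0 < lam0.
  rewrite lt_neqAle lam0_ge0 andbT; apply/eqP => lam0_eq0.
  (* One time in the first stage where the minimum is attained is enough to contradict
     nontriviality. *)
  have [s s01] := ae_itv01_exists _ (umin (Ordinal N_gt0)).
  rewrite -lam0_eq0 => umin_s; apply: (nontriv (Ordinal N_gt0) s s01).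
  by rewrite -lam0_eq0 (argmin_hamiltonian_abnormal _ _ _ _ _ _ _ _ umin_s).
have aeF := @ae_lebesgue_filter R.
have k0 : 0 < lam0^-1 by rewrite invr_gt0.
have HZ i y s l v : hamiltonian t f i y 1 (lam0^-1 *: l) v s =
    lam0^-1 * hamiltonian t f i y lam0 l v s.
  by rewrite -hamiltonianZ mulVf// gt_eqF.
split=> //; split.
  split=> //; first by move=> i; exact: W1infty01Z.
  split.
  - by move=> i s _ [/eqP]; rewrite oner_eq0.
  - move=> i j; move: (adj i j); apply: filterS => s lam' s01.
    under eq_fun do rewrite mxE.
    rewrite (_ : (fun y => hamiltonian _ _ _ y 1 _ _ _) = lam0^-1 \*:
      (fun y => hamiltonian t f i y lam0 (lam i s) (u i s) s)); last first.
      exact/funext.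
    have /f_C1[df _] := stage_time_itv t i s t_incr s01.
    have dH := derivable_hamiltonian t f i lam0 (lam i s) (u i s) s (x i s)
      (delta_mx 0 j) (df _).
    by rewrite deriveZ// -scalerN; exact: is_deriveZ (lam' s01).
  - have [delta lam_jump] := jump.
    exists (fun i => lam0^-1 *: delta i) => i i' ii' j.
    by rewrite !mxE -mulrDr (lam_jump i i').
  - move=> i; move: (umin i); apply: filterS => s umin_s s01 w.
    by rewrite !HZ ler_pM2l// umin_s.
(* There are finitely many stages, so one null set of global times serves them all. *)
have ae_u : {ae lebesgue_measure, forall r : R, forall i,
    0 <= (r - t (start_knot i)) / tau t i <= 1 ->
    u i ((r - t (start_knot i)) / tau t i) =
    - (lam0^-1 *: lam i ((r - t (start_knot i)) / tau t i))}.
  apply: filter_forall => i.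
  apply: (ae_affine _ _ (fun s => 0 <= s <= 1 ->
    u i s = - (lam0^-1 *: lam i s))) => //.
  move: (umin i); apply: filterS => s umin_s s01.
  exact: argmin_hamiltonian_normal (umin_s s01).
move: ae_u; apply: filterS => r ae_r _; rewrite /concat.
(* If no stage contains [r], both concatenations take the default value 0. *)
case: pickP => [i /andP[t_le_r r_lt_t]|_]; last by rewrite oppr0.
apply: ae_r; apply/andP; split.
  by rewrite divr_ge0 ?subr_ge0// ltW.
by rewrite ler_pdivrMr// mul1r lerD2r ltW.
Qed.
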